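(* Let $d$ be any positive integer which is not of the form $4r+2$. Then for any $x$-component of an integer solution $(x,y)$ of the Pell equation $x^2-dy^2=1$ other than $(\pm 1,0)$, $xd$ is a congruent number. Furthermore, if $x$ is itself a square, then $d$ is also a congruent number.
   Context: A rational number $n$ is called a congruent number if there exist positive rational numbers $u,v,w$ with $u^2+v^2=w^2$ and $\frac{1}{2}uv=n$. Congruent numbers are not required to be square-free.
   Formalization: The formal statement claims that |x|d, not xd, is a congruent number: congruent numbers are positive, so the claim for xd fails for negative x (d = 3, (x,y) = (-2,1) gives xd = -6); for x > 0 the two agree. *)

(* Defs.v *)
From mathcomp Require Import all_boot all_order all_algebra.

Set Implicit Arguments.
Unset Strict Implicit.
Unset Printing Implicit Defensive.

Import Order.TTheory GRing.Theory Num.Theory.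

Local Open Scope ring_scope.

(* The legs are positive, so a congruent number is always positive. *)
Definition congruent_number (n : rat) : Prop :=
  exists u v w : rat,
    [/\ 0 < u, 0 < v, 0 < w, u ^+ 2 + v ^+ 2 = w ^+ 2 & u * v / 2 = n].

Definition pell_solution (d x y : int) : Prop := x ^+ 2 - d * y ^+ 2 = 1.

Definition int_square (x : int) : Prop := exists s : int, x = s ^+ 2.

(* Main.v *)
Require Import Defs.
From mathcomp Require Import all_boot all_order all_algebra.
From mathcomp Require Import ring lra.

(** Euclid's triangle with parameters [a] and [1] has legs [2 a] and
    [a ^+ 2 - 1], hypotenuse [a ^+ 2 + 1] and area [a * (a ^+ 2 - 1)].  For
    [a = `|x|] the Pell equation turns this area into [`|x| * d * y ^+ 2], and
    a congruent number stays congruent when a nonzero square factor is removed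
    ([congruent_number_div_sqr]); removing [y ^+ 2] gives the first claim.
    If moreover [x = s ^+ 2], then [`|x| * d = d * s ^+ 2], and removing
    [s ^+ 2] gives the second.  That the solution is not [(1, 0)] or [(-1, 0)]
    is what makes [y] nonzero and the triangle nondegenerate. *)

Import Order.TTheory GRing.Theory Num.Theory.

Local Open Scope ring_scope.

Lemma congruent_number_euclid (a : rat) :
  1 < a -> congruent_number (a * (a ^+ 2 - 1)).
Proof.
move=> a_gt1; exists (2 * a), (a ^+ 2 - 1), (a ^+ 2 + 1).
by split; [nra | nra | nra | ring | field].
Qed.

(** Shrinking a right triangle by the ratio [`|c|] divides its area by
    [c ^+ 2]. *)
Lemma congruent_number_div_sqr (n c : rat) :
  c != 0 -> congruent_number (n * c ^+ 2) -> congruent_number n.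
Proof.
move=> c_neq0 [u [v [w [u_gt0 v_gt0 w_gt0 pyth area]]]].
have c_gt0 : 0 < `|c| by rewrite normr_gt0.
exists (u / `|c|), (v / `|c|), (w / `|c|); split; try exact: divr_gt0.
  by rewrite !expr_div_n -mulrDl pyth.
apply: (mulIf (x := c ^+ 2)); first by rewrite expf_neq0.
rewrite -area -(real_normK (num_real c)); field.
by rewrite normr_eq0.
Qed.

Lemma pell_solution_y_neq0 {d x y : int} :
  pell_solution d x y -> (x, y) <> (1, 0) -> (x, y) <> (-1, 0) -> y != 0.
Proof.
move=> pell ne1 neN1; apply/eqP => y0; move: pell ne1 neN1.
rewrite /pell_solution y0 expr0n mulr0 subr0 => /eqP.
by rewrite sqrf_eq1 => /orP[] /eqP ->.
Qed.

Lemma pell_solution_norm_x_gt1 {d x y : int} :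
  0 < d -> pell_solution d x y -> y != 0 -> 1 < `|x|.
Proof.
move=> d_gt0 pell y_neq0.
have dy2_gt0 : 0 < d * y ^+ 2 by rewrite mulr_gt0 // exprn_even_gt0.
rewrite -(@ltr_pXn2r _ 2) ?nnegrE // expr1n real_normK ?num_real //.
by rewrite -subr_gt0 -pell opprB addrCA subrr addr0.
Qed.

Theorem theorem4p13 (d : int) (hd : 0 < d)
  (hd4 : ~ (exists r : int, d = 4 * r + 2))
  (x y : int) (hxy : pell_solution d x y)
  (hne1 : (x, y) <> (1, 0)) (hneN1 : (x, y) <> (-1, 0)) :
  congruent_number (`|x| * d)%:~R
  /\ (int_square x -> congruent_number d%:~R).
Proof.
have y_neq0 := pell_solution_y_neq0 hxy hne1 hneN1.
have x_gt1 := pell_solution_norm_x_gt1 hd hxy y_neq0.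
have cong_xd : congruent_number (`|x| * d)%:~R.
  apply: (@congruent_number_div_sqr _ y%:~R); first by rewrite intr_eq0.
  have area : `|x| * d * y ^+ 2 = `|x| * (`|x| ^+ 2 - 1).
    by rewrite real_normK ?num_real // -hxy opprB addrCA subrr addr0 -mulrA.
  rewrite -rmorphXn -rmorphM area rmorphM rmorphB rmorphXn rmorph1.
  by apply: congruent_number_euclid; rewrite ltr1z.
split=> // -[s x_eq]; apply: (@congruent_number_div_sqr _ s%:~R).
  rewrite intr_eq0; apply: contraTneq x_gt1 => s0.
  by rewrite x_eq s0 expr0n normr0.
rewrite -rmorphXn -rmorphM mulrC -x_eq.
by rewrite -[x in x * d]ger0_norm // x_eq sqr_ge0.
Qed.
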